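(* If $T$ is a subcubic tree, then $\gamma(T)=\gamma_e(T)$ if and only if $T\in\mathcal{T}$.
   Context: All graphs are finite, simple and undirected; subcubic means maximum degree at most $3$; an endvertex is a vertex of degree at most $1$; $P_1$ is the one-vertex graph. $\gamma(G)$ is the domination number of $G$; a minimum dominating set is a dominating set of size $\gamma(G)$. For $X\subseteq V(G)$, $\gamma(G,X)$ is the minimum size of a set $D\subseteq V(G)$ such that every vertex of $X\setminus D$ has a neighbor in $D$. For $D\subseteq V(G)$ and vertices $u,v$, $\mathrm{dist}_{(G,D)}(u,v)$ is the minimum number of edges of a path $P$ in $G$ between $u$ and $v$ such that $D$ contains exactly one endvertex of $P$ and no internal vertex of $P$ ($\infty$ if none; $\mathrm{dist}_{(G,D)}(u,u)=0$ for $u\in D$); $w_{(G,D)}(u)=\sum_{v\in D}\left(\frac12\right)^{\mathrm{dist}_{(G,D)}(u,v)-1}$ with $\left(\frac12\right)^\infty=0$. $D$ is an exponential dominating set if $w_{(G,D)}(u)\ge1$ for all $u\in V(G)$; $\gamma_e(G)$ is the minimum size of such a set. For a graph $G$ and vertex $x$, $\tau_G(x)$ is the minimum real $\tau$ such that there exists $D\subseteq V(G)$ with $|D|<\gamma_e(G)$, $x\notin D$, and $w_{(G,D)}(u)+\left(\frac12\right)^{\mathrm{dist}_{G-D}(x,u)}\tau\ge 1$ for every $u\in V(G)\setminus D$ (here $\mathrm{dist}_{G-D}$ is the usual distance in $G-D$). Operations on trees, producing a tree $T$ from a tree $T'$: Operation 1: $T$ has an endvertex $y$ with neighbor $x$ such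 that $T'=T-y$ and $x$ belongs to some minimum dominating set of $T'$. Operation 2: $T$ contains a path $xyz$ where $y$ has degree $2$ in $T$, $z$ is an endvertex of $T$, $T'=T-\{y,z\}$, and $\tau_{T'}(x)>1$ or $\gamma(T',V(T')\setminus\{x\})<\gamma(T')$. Operation 3: $T$ contains a path $wxyz$ where $x$ and $y$ have degree $2$ in $T$, $z$ is an endvertex of $T$, $T'=T-\{x,y,z\}$, and $\tau_{T'}(w)>\frac12$. $\mathcal{T}$ is the family of subcubic trees obtained from $P_1$ by applying finite sequences of Operations 1, 2, 3. *)

(* Defs.v *)
(* Graphs: a finite simple graph is a relation e on a finType V,
   assumed symmetric and irreflexive. Real-valued weights are taken in rat
   (all quantities involved are rational). *)
From HB Require Import structures.
From mathcomp Require Import all_boot all_order all_algebra.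
Set Implicit Arguments. Unset Strict Implicit. Unset Printing Implicit Defensive.
Import Order.TTheory GRing.Theory Num.Theory.

Section Defs.
Variable V : finType.
Implicit Types (e : rel V) (D X : {set V}).

Definition simple_graph e := symmetric e /\ irreflexive e.

Definition subcubic e := forall v : V, #|[pred u | e v u]| <= 3.

Definition is_tree e :=
  0 < #|V| /\ (forall u v : V, connect e u v) /\
  ~ (exists s : seq V, [/\ 3 <= size s, uniq s & cycle e s]).

Definition dominating e D := [forall v, (v \in D) || [exists u in D, e u v]].
Definition gamma e : nat := #|[arg min_(D < setT | dominating e D) #|D| ]|.

Definition dominatesX e X D := [forall v, (v \in X :\: D) ==> [exists u in D, e u v]].
Definition gammaX e X : nat := #|[arg min_(D < setT | dominatesX e X D) #|D| ]|.

Definition dpathb e D (u v : V) (k : nat) : bool :=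
  [exists p : k.-tuple V,
    [&& path e u p, last u p == v, uniq (u :: p),
        (u \in D) != (v \in D) &
        all [pred z | z \notin D] (behead (belast u p))]].

(* dist_{(G,D)}(u,v); None stands for infinity.  A path has fewer than #|V| edges. *)
Definition distD e D (u v : V) : option nat :=
  if (u == v) && (u \in D) then Some 0%N else
  if [seq k <- iota 0 #|V| | dpathb e D u v k] is k :: _ then Some k else None.

Definition wgt e D (u : V) : rat :=
  \sum_(v in D)
     match distD e D u v with Some k => (2%:R / 2%:R ^+ k)%R | None => 0%R end.

Definition exp_dominating e D := [forall u, (1 <= wgt e D u)%R].
Definition gamma_e e : nat := #|[arg min_(D < setT | exp_dominating e D) #|D| ]|.

Definition avpathb e D (x u : V) (k : nat) : bool :=
  [exists p : k.-tuple V,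
    [&& path e x p, last x p == u, uniq (x :: p) &
        all [pred z | z \notin D] (x :: p)]].

Definition dist_avoid e D (x u : V) : option nat :=
  if [seq k <- iota 0 #|V| | avpathb e D x u k] is k :: _ then Some k else None.

Definition half_pow (d : option nat) : rat :=
  match d with Some k => (1 / 2%:R ^+ k)%R | None => 0%R end.

Definition tau_feasible e (x : V) (t : rat) : Prop :=
  exists D, [/\ #|D| < gamma_e e, x \notin D &
    forall u, u \notin D -> (1 <= wgt e D u + half_pow (dist_avoid e D x u) * t)%R].

Definition is_tau e (x : V) (t : rat) : Prop :=
  tau_feasible e x t /\ forall t', tau_feasible e x t' -> (t <= t')%R.

Definition tau_gt e (x : V) (c : rat) : Prop := exists t, is_tau e x t /\ (c < t)%R.

End Defs.

(* f : V' -> V identifies G' = (V', e') with G - N, where N is the list of new vertices *)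
Definition embeds_as_minus (V' V : finType) (e' : rel V') (e : rel V)
    (f : V' -> V) (N : seq V) : Prop :=
  [/\ injective f,
      forall v : V, (v \in N) = (v \notin codom f),
      uniq N &
      forall a b : V', e' a b = e (f a) (f b)].

Definition op1 (V' V : finType) (e' : rel V') (e : rel V) : Prop :=
  exists (f : V' -> V) (x' : V') (y : V),
    [/\ embeds_as_minus e' e f [:: y],
        forall v, e y v = (v == f x') &
        exists D : {set V'}, [/\ dominating e' D, #|D| = gamma e' & x' \in D]].

Definition op2 (V' V : finType) (e' : rel V') (e : rel V) : Prop :=
  exists (f : V' -> V) (x' : V') (y z : V),
    [/\ embeds_as_minus e' e f [:: y; z],
        forall v, e y v = (v == f x') || (v == z),
        forall v, e z v = (v == y) &
        tau_gt e' x' 1%R \/ gammaX e' (setT :\ x') < gamma e'].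

Definition op3 (V' V : finType) (e' : rel V') (e : rel V) : Prop :=
  exists (f : V' -> V) (w' : V') (x y z : V),
    [/\ embeds_as_minus e' e f [:: x; y; z],
        forall v, e x v = (v == f w') || (v == y),
        forall v, e y v = (v == x) || (v == z),
        forall v, e z v = (v == y) &
        tau_gt e' w' (1 / 2%:R)%R].

Inductive obtainable : forall V : finType, rel V -> Prop :=
  | obt_P1 (V : finType) (e : rel V) :
      #|V| = 1%N -> (forall u v : V, ~~ e u v) -> obtainable e
  | obt_op1 (V' V : finType) (e' : rel V') (e : rel V) :
      simple_graph e -> obtainable e' -> op1 e' e -> obtainable e
  | obt_op2 (V' V : finType) (e' : rel V') (e : rel V) :
      simple_graph e -> obtainable e' -> op2 e' e -> obtainable e
  | obt_op3 (V' V : finType) (e' : rel V') (e : rel V) :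
      simple_graph e -> obtainable e' -> op3 e' e -> obtainable e.

Definition familyT (V : finType) (e : rel V) : Prop := subcubic e /\ obtainable e.

(* Main.v *)
(* In a tree the weight of a vertex u outside D is the sum over its neighbors y
   of a branch weight, which is 1 if y lies in D and otherwise half the sum of
   the branch weights at the other neighbors of y; in a subcubic tree branch
   weights are at most 1.  Hence, when a part A hangs off the tree at a vertex
   y, replacing the elements of D in A by y decreases no weight outside A.
   This determines how gamma_e changes when a pendant vertex, edge or path of
   order 3 is removed: tau is the threshold deciding whether gamma_e drops.
   Conversely, the end of a longest path z y x w ... of a tree with
   gamma = gamma_e allows an operation to be undone: Operation 1 if y has two
   leaf neighbors, Operation 2 if x has a further neighbor besides y and w
   (a leaf or the neighbor of a leaf), and Operation 3 otherwise.  In these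
   configurations the change of gamma is forced, and gamma = gamma_e for the
   larger tree then yields both gamma = gamma_e for the smaller tree and the
   required condition. *)
Require Import Defs.
From HB Require Import structures.
From mathcomp Require Import all_boot all_order all_algebra.
From mathcomp Require Import lra ring zify.
Set Implicit Arguments. Unset Strict Implicit. Unset Printing Implicit Defensive.
Import Order.TTheory GRing.Theory Num.Theory.

Definition tree (V : finType) (e : rel V) := simple_graph e /\ is_tree e.

Definition simple_path (V : eqType) (e : rel V) u v p :=
  [&& path e u p, last u p == v & uniq (u :: p)].

(** * Paths in trees *)

Section TreePaths.
Variables (V : finType) (e : rel V).
Hypothesis Te : tree e.
Implicit Types (u v x y z : V) (p q : seq V) (D A : {set V}).

Lemma tree_sym : symmetric e. Proof. by case: Te => -[]. Qed.
Lemma tree_irr : irreflexive e. Proof. by case: Te => -[]. Qed.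
Lemma tree_connect u v : connect e u v. Proof. by case: Te => _ [_ []]. Qed.
Lemma tree_acyclic s : 2 < size s -> uniq s -> ~~ cycle e s.
Proof. by case: Te => _ [_ [_ nc]] hs us; apply/negP => cs; apply: nc; exists s. Qed.

(** Cut both paths at the first vertex [c] of the first one that also lies on the second. The two
    initial segments then close up to a cycle through [u] and [c], which acyclicity allows only if
    both segments consist of the single edge from [u] to [c]. *)
Lemma simple_path_cycle u v a b p q :
  simple_path e u v (a :: p) -> simple_path e u v (b :: q) -> a = b.
Proof.
move=> /and3P[pa /eqP la ua] /and3P[pb /eqP lb ub].
have: has (mem (b :: q)) (a :: p).
  apply/hasP; exists v; first by rewrite -la; exact: (mem_last a p).
  by rewrite -lb; exact: (mem_last b q).
move E1: (a :: p) pa ua la => ap pa ua la hp.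
case: (split_find hp) pa ua E1 => c p1 p2 /= cin np1 pa ua E1.
move E2: (b :: q) pb ub cin np1 => bq pb ub cin np1.
case: (path.splitP cin) pb ub E2 np1 => q1 q2 pb ub E2 np1.
have pp: path e u (rcons p1 c) by move: pa; rewrite cat_path => /andP[].
have pq: path e u (rcons q1 c) by move: pb; rewrite cat_path => /andP[].
have pr: path e c (rcons (rev q1) u).
  have := rev_path e u (rcons q1 c).
  rewrite last_rcons belast_rcons rev_cons => ->.
  by rewrite (eq_path (e' := e)) // => s t; rewrite tree_sym.
have cyc: cycle e (u :: p1 ++ c :: rev q1).
  by rewrite /cycle rcons_cat rcons_cons -cat_rcons cat_path pp last_rcons.
have us: uniq (u :: p1 ++ c :: rev q1).
  move: ua ub; rewrite !cons_uniq !cat_uniq !mem_cat !mem_rcons !rcons_uniq.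
  rewrite !in_cons cons_uniq rev_uniq mem_rev !negb_or.
  move=> /and4P[/andP[/andP[-> ->] _] /andP[cp1 ->] _ _].
  move=> /and4P[/andP[/andP[_ ->] _] /andP[cq1 ->] _ _] /=.
  rewrite cp1 mem_rev cq1 /= andbT; apply/hasPn => w; rewrite mem_rev => wq /=.
  apply: contra np1 => wp; apply/hasP; exists w => //=.
  by rewrite mem_cat mem_rcons in_cons wq orbT.
have := @tree_acyclic (u :: p1 ++ c :: rev q1); rewrite cyc us /=.
rewrite size_cat /= size_rev.
case: p1 {pa np1 ua hp pp cyc us} E1 => [|a' p1] /=;
  last by rewrite !addnS => _ /(_ isT isT).
case: q1 {pb ub cin pq pr} E2 => [|b' q1] /=; last by move=> _ _ /(_ isT isT).
by move=> [-> _] [-> _].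
Qed.

Lemma simple_path_inj u v p q :
  simple_path e u v p -> simple_path e u v q -> p = q.
Proof.
elim: p u q => [|a p IH] u [|b q] //.
- move=> /and3P[_ /eqP/= <- _] /and3P[_ /eqP/= lq /andP[]].
  by rewrite -{1}lq mem_last.
- move=> /and3P[_ /eqP/= lq /andP[+ _]] /and3P[_ /eqP/= E _].
  by rewrite E -lq mem_last.
move=> h1 h2; have eab := simple_path_cycle h1 h2; subst b.
case/and3P: h1 => /= /andP[_ h1] h1' /andP[_ h1''].
case/and3P: h2 => /= /andP[_ h2] h2' /andP[_ h2''].
by congr (_ :: _); apply: IH (a) _ _ _; apply/and3P.
Qed.

Lemma simple_path_exists u v : exists p, simple_path e u v p.
Proof.
have /connectP[p pp lp] := tree_connect u v.
case: (shortenP pp) lp => p' pp' up' _ lp'.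
by exists p'; rewrite /simple_path pp' up' lp' eqxx.
Qed.

(** The start [u] is left out of the list, so its size is the distance of [u] and [v]. *)
Definition pth u v := xchoose (simple_path_exists u v).

Lemma pthP u v : simple_path e u v (pth u v).
Proof. exact: xchooseP. Qed.

Lemma pthE u v p : simple_path e u v p -> pth u v = p.
Proof. exact: simple_path_inj (pthP u v). Qed.

Lemma last_pth u v : last u (pth u v) = v.
Proof. by case/and3P: (pthP u v) => _ /eqP. Qed.

Lemma path_pth u v : path e u (pth u v).
Proof. by case/and3P: (pthP u v). Qed.

Lemma uniq_pth u v : uniq (u :: pth u v).
Proof. by case/and3P: (pthP u v). Qed.

Lemma pth_refl u : pth u u = [::].
Proof. by apply: pthE; rewrite /simple_path /= eqxx. Qed.

Lemma pth_adj u v : e u v -> pth u v = [:: v].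
Proof.
move=> euv; apply: pthE; rewrite /simple_path /= euv eqxx inE /= andbT.
by apply: contraTneq euv => ->; rewrite tree_irr.
Qed.

Lemma size_pth u v : size (pth u v) < #|V|.
Proof. by have /card_uniqP E := uniq_pth u v; rewrite -[_.+1]E max_card. Qed.

Lemma pth_rev u v : v :: pth v u = rev (u :: pth u v).
Proof.
have [[pp lp] up] := (path_pth u v, last_pth u v, uniq_pth u v).
have -> : rev (u :: pth u v) = v :: rev (belast u (pth u v)).
  by rewrite lastI rev_rcons lp.
congr (_ :: _); apply: pthE; apply/and3P; split.
- rewrite -{1}lp rev_path (eq_path (e' := e)) // => s t; exact: tree_sym.
- by case: (pth u v) lp => [|a p] //= lp; rewrite ?lp // rev_cons last_rcons.
- by have := congr1 rev (lastI u (pth u v)); rewrite lp rev_rcons => <-; rewrite rev_uniq.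
Qed.

Lemma size_pthC u v : size (pth u v) = size (pth v u).
Proof. by have := congr1 size (pth_rev u v); rewrite size_rev => -[]. Qed.

Lemma pth_cons u v y q : pth u v = y :: q -> e u y /\ q = pth y v.
Proof.
move=> E; have := pthP u v; rewrite E => /and3P[/=/andP[euy pp] lp /andP[_ up]].
by split=> //; apply/esym/pthE/and3P.
Qed.

(** Removing the edge [u y] separates the tree, and [v] lies on exactly one side. If the path from
    [y] to [v] does not start with [u], it avoids [u] altogether, because its part up to [u] would
    have to be the edge itself; hence [u] can be put in front of it. *)
Lemma pth_step u v y : e u y ->
  (ohead (pth u v) == Some y) = (ohead (pth y v) != Some u).
Proof.
move=> euy; apply/idP/idP.
  case E: (pth u v) => [|y' q] //= /eqP[?]; subst y'.
  have [_ qE] := pth_cons E; have := uniq_pth u v; rewrite E qE /=.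
  case: (pth y v) => [|a r] /=; first by [].
  by rewrite !inE !negb_or => /andP[/and3P[_ H _] _]; apply: contra H => /eqP[->].
move=> h; rewrite (@pthE u v (y :: pth y v)) //; apply/and3P; split=> /=.
- by rewrite euy path_pth.
- by rewrite last_pth.
rewrite [X in _ && X](uniq_pth y v) andbT inE negb_or.
have nuy : u != y by apply: contraTneq euy => ->; rewrite tree_irr.
rewrite nuy /=; apply: contra h => uin.
have eyu : e y u by rewrite tree_sym.
have [pp up] := (path_pth y v, uniq_pth y v).
case: (path.splitP uin) pp up => p1 p2 pp up.
suff -> : rcons p1 u = [:: u] by [].
rewrite -(pth_adj eyu); apply/esym/pthE/and3P.
move: pp up; rewrite cat_path -cat_cons cat_uniq => /andP[-> _] /and3P[-> _ _].
by rewrite last_rcons eqxx.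
Qed.

Lemma pth_stepE u v y : ohead (pth u v) = Some y -> pth u v = y :: pth y v.
Proof.
by case E: (pth u v) => [|a q] //= -[<-]; have [_ <-] := pth_cons E.
Qed.

End TreePaths.

(** * Branch weights *)

(** In a tree only one length is possible for a path between two given vertices, so the filtered
    lists in [distD] and [dist_avoid] have at most one entry. *)
Lemma filter_iota_pred1 (P : pred nat) n k :
  k < n -> (forall j, P j -> j = k) ->
  filter P (iota 0 n) = if P k then [:: k] else [::].
Proof.
move=> kn Pk; have E : P =1 (fun j => (j == k) && P k).
  by move=> j; apply/idP/andP => [Pj|[/eqP->]] //; rewrite -(Pk _ Pj) eqxx.
rewrite (eq_filter E); case: (P k).
  under eq_filter => j do rewrite andbT.
  by rewrite filter_pred1_uniq ?iota_uniq // mem_iota.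
by under eq_filter => j do rewrite andbF; rewrite filter_pred0.
Qed.

Section TreeWeights.
Variables (V : finType) (e : rel V).
Hypothesis Te : tree e.
Implicit Types (u v x y z : V) (p q : seq V) (D A : {set V}).
Local Notation pth := (pth Te).
Local Open Scope ring_scope.

Lemma distDE D u v : u \notin D -> v \in D ->
  distD e D u v = if all [pred z | z \notin D] (belast u (pth u v))
                  then Some (size (pth u v)) else None.
Proof.
move=> uD vD; rewrite /distD (negPf uD) andbF.
have nuv : u != v by apply: contraNneq uD => ->.
have E k : dpathb e D u v k = (k == size (pth u v)) &&
    all [pred z | z \notin D] (belast u (pth u v)).
  have pE : belast u (pth u v) = u :: behead (belast u (pth u v)).
    case: (pth u v) (last_pth Te u v) => [|a p] //= uv.
    by rewrite uv eqxx in nuv.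
  rewrite pE /= uD /=; apply/existsP/andP.
    case=> p /and5P[pp lp up _ ap].
    have E : pth u v = p by apply: pthE; apply/and3P.
    by rewrite E size_tuple eqxx.
  case=> /eqP-> ap; exists (in_tuple (pth u v)); rewrite path_pth last_pth.
  by rewrite uniq_pth eqxx (negPf uD) vD ap.
rewrite (@filter_iota_pred1 _ _ (size (pth u v))).
- by rewrite E eqxx /=; case: (all _ _).
- exact: size_pth.
- by move=> j; rewrite E => /andP[/eqP].
Qed.

Lemma dist_avoidE D x u :
  dist_avoid e D x u = if all [pred z | z \notin D] (x :: pth x u)
                       then Some (size (pth x u)) else None.
Proof.
rewrite /dist_avoid.
have E k : avpathb e D x u k = (k == size (pth x u)) &&
    all [pred z | z \notin D] (x :: pth x u).
  apply/existsP/andP.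
    case=> p /and4P[pp lp up ap].
    have E : pth x u = p by apply: pthE; apply/and3P.
    by rewrite E size_tuple eqxx.
  case=> /eqP-> ap; exists (in_tuple (pth x u)); rewrite path_pth last_pth.
  by rewrite uniq_pth eqxx ap.
rewrite (@filter_iota_pred1 _ _ (size (pth x u))).
- by rewrite E eqxx /=; case: (all _ _); rewrite ?andbT ?andbF; case: (x \notin D).
- exact: size_pth.
- by move=> j; rewrite E => /andP[/eqP].
Qed.

Lemma half_pow_ge0 d : 0 <= half_pow d.
Proof. by case: d => [k|] //=; rewrite divr_ge0 ?exprn_ge0. Qed.

(** The path is read from [u] towards [x], the direction used by [term], so that it can be continued
    beyond [x]. *)
Lemma half_pow_dist_avoidE D x u :
  half_pow (dist_avoid e D x u) =
  (all [pred z | z \notin D] (u :: pth u x))%:R / 2%:R ^+ size (pth u x).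
Proof.
rewrite dist_avoidE -(all_rev _ (u :: _)) -pth_rev (size_pthC Te x u).
by case: all; rewrite /= ?mul0r.
Qed.

(** The contribution of [v] in [D] to the weight of a vertex [u] outside [D]. The [belast] spares
    the end [v] from the test, and the numerator 2 accounts for the exponent being the distance
    minus one. *)
Definition term D u v : rat :=
  (all [pred z | z \notin D] (belast u (pth u v)))%:R
    * (2%:R / 2%:R ^+ size (pth u v)).

Lemma term_ge0 D u v : 0 <= term D u v.
Proof. by rewrite mulr_ge0 ?ler0n // divr_ge0 ?exprn_ge0. Qed.

Lemma wgtE D u : u \notin D -> wgt e D u = \sum_(v in D) term D u v.
Proof.
move=> uD; apply: eq_bigr => v vD; rewrite distDE // /term.
by case: all; rewrite ?mul1r ?mul0r.
Qed.

Lemma wgt_in D u : u \in D -> 1 <= wgt e D u.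
Proof.
move=> uD; rewrite /wgt (bigD1 u) //= /distD eqxx uD /= expr0 divr1.
apply: ler_wpDr; rewrite ?ler1n //; apply: sumr_ge0 => v _.
by case: ifP => // _; case: (filter _ _) => [|k l] //; rewrite divr_ge0 ?exprn_ge0.
Qed.

Lemma term_adj D u v : e u v -> u \notin D -> term D u v = 1.
Proof.
by move=> euv uD; rewrite /term pth_adj //= uD mul1r expr1 divff ?pnatr_eq0.
Qed.

Lemma wgt_adj D u v : u \notin D -> v \in D -> e u v -> 1 <= wgt e D u.
Proof.
move=> uD vD euv; rewrite wgtE // (bigD1 v) //= term_adj //.
by rewrite lerDl sumr_ge0 // => w _; exact: term_ge0.
Qed.

Lemma dominating_exp D : dominating e D -> exp_dominating e D.
Proof.
move=> /forallP dD; apply/forallP => u; have := dD u.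
case: (boolP (u \in D)) => [uD _|uD /existsP[v /andP[vD euv]]].
  exact: wgt_in.
by apply: wgt_adj uD vD _; rewrite tree_sym.
Qed.

(* n is fuel, measuring path length: #|V| is always enough (see wgt_branch). *)
Fixpoint branch D n u y : rat :=
  if n is n.+1 then
    if y \in D then 1 else (\sum_(z | e y z && (z != u)) branch D n y z) / 2%:R
  else 0.

Lemma term_step D u v y : u \notin D -> ohead (pth u v) = Some y ->
  y \notin D -> term D u v = term D y v / 2%:R.
Proof.
move=> uD h yD; rewrite /term (pth_stepE h) /= uD /= exprS invfM.
by rewrite !mulrA -!mulrA [_^-1 * 2%:R^-1]mulrC.
Qed.

Lemma term_blocked D u v y : ohead (pth u v) = Some y -> y \in D -> v != y ->
  term D u v = 0.
Proof.
move=> h yD vy; rewrite /term (pth_stepE h).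
have : pth y v != [::].
  by apply: contra vy => /eqP E; have := last_pth Te y v; rewrite E /= => ->.
by case: (pth y v) => [|a q] //= _; rewrite yD andbF mul0r.
Qed.

(** If [y] is in [D], it contributes 1 and blocks every path beyond it. Otherwise the edge [u y]
    costs a factor 1/2, and the remaining paths are sorted by the vertex [z] after [y], which
    differs from [u] on a simple path. *)
Lemma branchE D n u y : u \notin D -> e u y ->
  branch D n u y =
  \sum_(v in D | (ohead (pth u v) == Some y) && (size (pth u v) <= n)%N) term D u v.
Proof.
elim: n u y => [|n IH] u y uD euy /=.
  by rewrite big_pred0 // => v; case: (pth u v) => [|a q]; rewrite /= ?andbF.
case: ifPn => yD.
  rewrite (bigD1 y) /=; last by rewrite pth_adj //= yD eqxx.
  rewrite term_adj // big1 ?addr0 // => v /andP[/and3P[vD /eqP h _] vy].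
  exact: term_blocked h yD vy.
have key v : v \in D ->
    (ohead (pth u v) == Some y) && (size (pth u v) <= n.+1)%N =
    (ohead (pth y v) != Some u) && (size (pth y v) <= n)%N.
  move=> vD; rewrite (pth_step Te v euy); case: eqP => //= h.
  have /eqP h' : ohead (pth u v) == Some y by rewrite pth_step //; apply/eqP.
  by rewrite (pth_stepE h').
transitivity (\sum_(v in D | (ohead (pth y v) != Some u) &&
    (size (pth y v) <= n)%N) term D y v / 2%:R); last first.
  apply: eq_big => [v|v /andP[vD h]].
    by case: (boolP (v \in D)) => //= vD; rewrite key.
  by move: h; rewrite -key // => /andP[/eqP h _]; rewrite (term_step uD h).
rewrite -mulr_suml; congr (_ / _).
under eq_bigr => z /andP[eyz _] do rewrite IH //.
(* Each [v] is counted for exactly one [z], the first vertex of its path from [y]. *)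
rewrite (exchange_big_dep (fun v => (v \in D) && ((ohead (pth y v) != Some u) &&
    (size (pth y v) <= n)%N))) /=; last first.
  by move=> z v /andP[_ zu] /and3P[-> /eqP-> ->]; rewrite andbT.
apply: eq_bigr => v /and3P[vD h sn].
case E: (pth y v) h sn => [|a q] /= h sn.
  by rewrite -(last_pth Te y v) E /= (negPf yD) in vD.
have [eya _] := pth_cons E.
rewrite (big_pred1 a) // => z; rewrite vD sn andbT /=.
apply/andP/eqP => [[_ /eqP[]] //|->].
by rewrite eya eqxx.
Qed.

Lemma wgt_branch D u : u \notin D ->
  wgt e D u = \sum_(y | e u y) branch D #|V| u y.
Proof.
move=> uD; rewrite wgtE //; under [RHS]eq_bigr => y euy do rewrite branchE //.
rewrite (exchange_big_dep (mem D)) /=; last by move=> y v _ /andP[].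
apply: eq_bigr => v vD.
case E: (pth u v) => [|a q].
  by rewrite -(last_pth Te u v) E /= (negPf uD) in vD.
have [eua _] := pth_cons E.
rewrite (big_pred1 a) // => z; rewrite vD -E (ltnW (size_pth _ _ _)) andbT E /=.
apply/andP/eqP => [[_ /eqP[]] //|->].
by rewrite eua eqxx.
Qed.

Hypothesis Sc : subcubic e.

(** Besides [u], the vertex [y] has at most two neighbors, so half the sum of their branch weights
    is at most 1. *)
Lemma branch_le1 D n u y : e u y -> branch D n u y <= 1.
Proof.
elim: n u y => [|n IH] u y euy //=; case: ifP => // _.
rewrite ler_pdivrMr // mul1r.
apply: (@le_trans _ _ (\sum_(z | e y z && (z != u)) 1)).
  by apply: ler_sum => z /andP[/IH].
rewrite sumr_const ler_nat.
have S := Sc y; rewrite (cardD1 u) inE (tree_sym Te y u) euy add1n ltnS in S.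
apply: leq_trans S; apply: subset_leq_card; apply/subsetP => z.
by rewrite !inE unfold_in andbC.
Qed.

(** Vertices outside [A] see [A] only through [y]. Once [y] belongs to the set, its branch weight is
    1, which is the largest possible value and makes up for everything lost in [A]. *)
Lemma exp_dominating_retract A D y u :
  y \notin A -> (forall a v, a \in A -> e a v -> (v \in A) || (v == y)) ->
  u \notin A -> 1 <= wgt e D u -> 1 <= wgt e (y |: (D :\: A)) u.
Proof.
set D1 := y |: _ => yA sep uA.
have sub v : v \in D -> v \notin A -> v \in D1 by move=> vD vA; rewrite !inE vD vA orbT.
have mono n s v : e s v -> v \notin A -> branch D n s v <= branch D1 n s v.
  elim: n s v => [|n IH] s v esv vA //=.
  case: ifPn => vD; first by rewrite (sub v).
  (* If [v] is new in [D1], its branch weight rises to the maximum 1. Otherwise [v] is not [y], so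
     no neighbor of [v] lies in [A] and the induction continues outside [A]. *)
  have := branch_le1 D n.+1 esv; rewrite /= (negPf vD); case: ifPn => // vD1 _.
  rewrite ler_pM2r ?invr_gt0 //; apply: ler_sum => z /andP[evz _].
  apply: IH => //; apply: contra vD1 => zA; move: (sep z v zA).
  by rewrite tree_sym // => /(_ evz); rewrite (negPf vA) /= => /eqP->; rewrite !inE eqxx.
case: (boolP (u \in D1)) => [uD1 _|uD1]; first exact: wgt_in.
have uD : u \notin D by apply: contra uD1 => /sub; exact.
rewrite !wgt_branch // => h; apply: le_trans h _; apply: ler_sum => v euv.
apply: mono => //; apply: contra uD1 => vA; move: (sep v u vA).
by rewrite tree_sym // => /(_ euv); rewrite (negPf uA) /= => /eqP->; rewrite !inE eqxx.
Qed.

(** The only branch at [z] goes through [y], which passes on at most half of one branch weight. The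
    neighborhoods are bounded only from above, so [y] may also have no neighbor but [z], with [x]
    chosen at will. *)
Lemma wgt_leaf_lt1 D x y z :
  (forall v, e z v -> v = y) -> (forall v, e y v -> v = x \/ v = z) ->
  y \notin D -> z \notin D -> wgt e D z < 1.
Proof.
move=> zN yN yD zD; rewrite wgt_branch //.
have le_half : branch D #|V| z y <= 1 / 2%:R.
  case: #|V| => [|n] //=; rewrite (negPf yD) ler_pM2r ?invr_gt0 //.
  have [exy|nxy] := boolP (e y x && (x != z)); last first.
    rewrite big_pred0 // => v; apply/negbTE; apply: contra nxy => /andP[eyv vz].
    by case: (yN v eyv) => E; move: vz eyv; rewrite E ?eqxx // => -> ->.
  rewrite (big_pred1 x) => [|v].
    by case/andP: exy => exy _; exact: branch_le1.
  apply/andP/eqP => [[/yN[]-> //]|->]; first by rewrite eqxx.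
  by case/andP: exy.
have [ezy|nzy] := boolP (e z y).
  rewrite (big_pred1 y) => [|v]; last by apply/idP/eqP => [/zN|->].
  by apply: le_lt_trans le_half _; lra.
rewrite big_pred0 // => v; apply/negbTE; apply: contra nzy => ezv.
by rewrite -{1}(zN _ ezv).
Qed.

End TreeWeights.

(** * Trees with a pendant part *)

(** The common shape of the three operations: [N] lists the new vertices and [f x] is the only old
    vertex they can touch. *)
Definition pendant (V' V : finType) (e' : rel V') (e : rel V)
    (f : V' -> V) (N : seq V) (x : V') : Prop :=
  embeds_as_minus e' e f N /\ forall a w, a \in N -> e a (f w) -> w = x.

Section Pendant.
Variables (V' V : finType) (e' : rel V') (e : rel V).
Variables (f : V' -> V) (N : seq V) (x : V').
Hypothesis Pf : pendant e' e f N x.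
Implicit Types (u v w : V') (a b : V) (D : {set V}).

Lemma pendant_inj : injective f. Proof. by case: Pf => -[]. Qed.
Lemma pendant_edge u v : e' u v = e (f u) (f v). Proof. by case: Pf => -[]. Qed.
Lemma pendant_notin u : f u \notin N.
Proof. by case: Pf => -[_ -> _ _] _; rewrite negbK codom_f. Qed.
Lemma pendant_preim a : a \notin N -> exists u, a = f u.
Proof. by case: Pf => -[_ -> _ _] _; rewrite negbK => /codomP. Qed.
Lemma pendant_attach a w : a \in N -> e a (f w) -> w = x.
Proof. by case: Pf => _; apply. Qed.

Lemma pendant_card : #|V| = #|V'| + size N.
Proof.
have uN : uniq N by case: Pf => -[].
rewrite -(card_codom pendant_inj) -(card_uniqP uN) -(cardC (mem (codom f))).
congr (_ + _); apply: eq_card => a; rewrite !inE.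
by case: Pf => -[_ -> _ _].
Qed.

Lemma pendant_subcubic : subcubic e -> subcubic e'.
Proof.
move=> Sc v; apply: leq_trans (Sc (f v)).
rewrite -(card_image pendant_inj); apply: subset_leq_card.
apply/subsetP => a /imageP[u]; rewrite !inE => + ->.
by rewrite pendant_edge.
Qed.

Lemma pendant_reenter a q :
  a \in N -> path e a q -> last a q \notin N -> f x \in q.
Proof.
elim: q a => [|b q IH] a aN /=; first by rewrite aN.
move=> /andP[eab pq] lq; rewrite inE; have [bN|bN] := boolP (b \in N).
  by rewrite (IH b) ?orbT.
have [w bE] := pendant_preim bN; rewrite bE in eab *.
by rewrite (pendant_attach aN eab) eqxx.
Qed.

(** A path between old vertices that entered [N] would leave through [f x] on the way in and return
    through [f x], so it would not be simple. *)
Lemma pendant_lift_path u p : symmetric e ->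
  path e (f u) p -> uniq (f u :: p) -> last (f u) p \notin N ->
  exists2 p', p = map f p' & path e' u p'.
Proof.
move=> es; elim: p u => [|b p IH] u; first by exists [::].
move=> /= /andP[eub pp] /andP[nu up] lp.
have [bN|bN] := boolP (b \in N).
  have := pendant_reenter bN pp lp.
  by rewrite -(@pendant_attach b u) // 1?es // => h; rewrite inE h orbT in nu.
have [w bE] := pendant_preim bN; subst b.
by have [p' -> pp'] := IH w pp up lp; exists (w :: p') => //=; rewrite pendant_edge eub.
Qed.

Hypothesis Te : tree e.

Lemma pendant_tree : tree e'.
Proof.
split; [split=> [u v|u] | split; last split].
- by rewrite !pendant_edge tree_sym.
- by rewrite pendant_edge tree_irr.
- by apply/card_gt0P; exists x.
- move=> u v; have := pthP Te (f u) (f v); case/and3P=> pp /eqP lp up.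
  have [|p' E pp'] := pendant_lift_path (tree_sym Te) pp up.
    by rewrite lp pendant_notin.
  apply/connectP; exists p' => //; apply: pendant_inj.
  by rewrite -lp E last_map.
- case=> s [ss us cs]; have := @tree_acyclic _ _ Te (map f s).
  rewrite size_map (map_inj_uniq pendant_inj) => /(_ ss us) /negP; apply.
  case: s cs {ss us} => [|a s] //=.
  by rewrite -map_rcons path_map; apply: sub_path => u v; rewrite pendant_edge.
Qed.

Let Te' := pendant_tree.
Local Notation "D ^-f" := (f @^-1: D) (at level 2).
Local Open Scope ring_scope.

Lemma pendant_pth u v : pth Te (f u) (f v) = map f (pth Te' u v).
Proof.
apply: pthE; apply/and3P; split.
- rewrite path_map; apply: sub_path (path_pth Te' u v) => s t.
  by rewrite /= pendant_edge.
- by rewrite last_map last_pth.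
- by rewrite -map_cons (map_inj_uniq pendant_inj) uniq_pth.
Qed.

Lemma pendant_term D u v : term Te D (f u) (f v) = term Te' (D^-f) u v.
Proof.
rewrite /term pendant_pth size_map; congr (_%:R * _).
rewrite belast_map all_map; congr (nat_of_bool _).
by apply: eq_all => w; rewrite /= inE.
Qed.

(** A path from an old vertex to a new one is the path to [f x] followed by [b :: r]. The
    contribution therefore factors into the coefficient of [tau] in the definition of [tau_feasible]
    and a constant that depends only on the part of the path in [N]. *)
Lemma pendant_term_out D u b r : all (mem N) (b :: r) ->
  simple_path e (f x) (last b r) (b :: r) ->
  term Te D (f u) (last b r) =
  half_pow (dist_avoid e' D^-f x u) *
    ((all [pred a | a \notin D] (belast b r))%:R * 2%:R / 2%:R ^+ (size r).+1).
Proof.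
move=> bN /and3P[pb _ ub].
have E : pth Te (f u) (last b r) = map f (pth Te' u x) ++ b :: r.
  apply: pthE; apply/and3P; split.
  - rewrite cat_path last_map last_pth pb andbT path_map.
    by apply: sub_path (path_pth Te' u x) => s t; rewrite /= pendant_edge.
  - by rewrite last_cat.
  - rewrite -cat_cons -map_cons cat_uniq (map_inj_uniq pendant_inj) uniq_pth andTb.
    apply/andP; split; last by case/andP: ub.
    apply/hasPn => a ab.
    apply/mapP => -[w _ aE]; have /allP/(_ a ab) := bN.
    by rewrite /= aE (negPf (pendant_notin w)).
rewrite /term E size_cat size_map.
rewrite belast_cat last_map last_pth /= -cat_rcons (half_pow_dist_avoidE Te').
have <- : f u :: map f (pth Te' u x) = rcons (belast (f u) (map f (pth Te' u x))) (f x).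
  by rewrite lastI last_map last_pth.
rewrite -map_cons all_cat all_map.
rewrite [all (preim f _) _](@eq_all _ _ [pred w | w \notin D^-f]); last first.
  by move=> w; rewrite /= inE.
case: (all _ (u :: _)); last by rewrite /= !mul0r.
rewrite exprD invfM mul1r andTb; move: (_ ^- _) (_ ^- _) => s t; ring.
Qed.

Lemma pendant_wgt D u : u \notin D^-f ->
  wgt e D (f u) = wgt e' D^-f u + \sum_(a in N | a \in D) term Te D (f u) a.
Proof.
move=> uD; have fuD : f u \notin D by rewrite inE in uD.
rewrite (wgtE Te) // (wgtE Te') // (bigID (mem N)) /= addrC; congr (_ + _); last first.
  by apply: eq_bigl => a; rewrite andbC.
rewrite (eq_bigl (mem (f @: D^-f))) => [|a].
  rewrite big_imset /=; last by move=> ? ? _ _ /pendant_inj.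
  by apply: eq_bigr => v _; exact: pendant_term.
apply/andP/imsetP => [[aD aN]|[v + ->]]; last by rewrite inE pendant_notin.
by have [v aE] := pendant_preim aN; exists v; rewrite ?inE -?aE.
Qed.

Lemma pendant_wgt_ge D u : u \notin D^-f -> wgt e' D^-f u <= wgt e D (f u).
Proof.
by move=> uD; rewrite pendant_wgt // lerDl sumr_ge0 // => a _; exact: term_ge0.
Qed.

Lemma pendant_exp_preim D : [disjoint D & N] ->
  (forall u, 1 <= wgt e D (f u)) -> exp_dominating e' D^-f.
Proof.
move=> DN eD; apply/forallP => u; have [uD|uD] := boolP (u \in D^-f).
  exact: wgt_in.
rewrite (le_trans (eD u)) // pendant_wgt // big_pred0 ?addr0 // => a.
by apply/negbTE/negP => /andP[aN aD]; have := disjointFr DN aD; rewrite aN.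
Qed.

(** The retraction for [A] equal to [N]: all new vertices of [D] are traded for [x]. *)
Lemma pendant_exp_retract D : subcubic e ->
  exp_dominating e D -> exp_dominating e' (x |: D^-f).
Proof.
move=> Sc /forallP eD; pose D1 := f x |: (D :\: [set a in N]).
have <- : D1^-f = x |: D^-f.
  by apply/setP => u; rewrite !inE pendant_notin (inj_eq pendant_inj).
apply: pendant_exp_preim => [|u].
  rewrite disjoint_subset; apply/subsetP => a; rewrite !inE.
  by move=> /predU1P[->|/andP[]//]; apply: pendant_notin.
apply: (exp_dominating_retract Te Sc); rewrite ?inE ?pendant_notin //.
move=> a v; rewrite !inE => aN eav; have [//|vN] := boolP (v \in N).
by have [w vE] := pendant_preim vN; subst v; rewrite (pendant_attach aN eav) eqxx ?orbT.
Qed.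

Lemma pendant_exp_preim_in D : x \in D^-f ->
  exp_dominating e D -> subcubic e -> exp_dominating e' D^-f.
Proof.
by move=> xD eD Sc; have := pendant_exp_retract Sc eD; rewrite (setUidPr _) // sub1set.
Qed.

Lemma pendant_cardD D : #|D| = (#|D^-f| + #|D :&: [set a in N]|)%N.
Proof.
rewrite -(cardsID [set a in N] D) addnC; congr (_ + _)%N.
rewrite -(card_imset _ pendant_inj); apply: eq_card => a.
rewrite !inE; apply/andP/imsetP => [[aN aD]|[v + ->]]; last by rewrite inE pendant_notin.
by have [v aE] := pendant_preim aN; exists v; rewrite ?inE -?aE.
Qed.

End Pendant.

(** * Domination parameters and tau *)

Section DominationParameters.
Variables (V : finType) (e : rel V).
Implicit Types (D X : {set V}) (x y a u v : V).

Definition dominated D v := (v \in D) || [exists u in D, e u v].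

Lemma dominated_in D v : v \in D -> dominated D v.
Proof. by rewrite /dominated => ->. Qed.

Lemma dominated_adj D u v : u \in D -> e u v -> dominated D v.
Proof.
by move=> uD euv; apply/orP; right; apply/existsP; exists u; rewrite uD.
Qed.

Lemma dominatedP D v :
  dominated D v -> v \in D \/ exists2 u, u \in D & e u v.
Proof.
by case/orP => [|/existsP[u /andP[uD euv]]]; [left | right; exists u].
Qed.

Lemma dominatedS D1 D2 v : D1 \subset D2 -> dominated D1 v -> dominated D2 v.
Proof.
move=> /subsetP s12 /dominatedP[/s12/dominated_in //|[u /s12 uD]].
exact: dominated_adj.
Qed.

Lemma dominatingP D : reflect (forall v, dominated D v) (dominating e D).
Proof. exact: forallP. Qed.

Lemma dominatesXP X D :
  reflect {in X, forall v, dominated D v} (dominatesX e X D).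
Proof.
apply: (iffP forallP) => h v.
  rewrite /dominated => vX; case: (boolP (v \in D)) => //= vD.
  by have := h v; rewrite inE vX vD.
apply/implyP; rewrite inE => /andP[vD vX].
by have := h v vX; rewrite /dominated (negPf vD).
Qed.

Lemma gammaP : exists2 D, dominating e D & #|D| = gamma e.
Proof.
rewrite /gamma; case: arg_minnP => [|D dD _]; last by exists D.
by apply/forallP => v; rewrite inE.
Qed.

Lemma gamma_le D : dominating e D -> gamma e <= #|D|.
Proof.
rewrite /gamma; case: arg_minnP => [|D0 _ min]; last exact: min.
by apply/forallP => v; rewrite inE.
Qed.

Lemma gammaXP X : exists2 D, dominatesX e X D & #|D| = gammaX e X.
Proof.
rewrite /gammaX; case: arg_minnP => [|D dD _]; last by exists D.
by apply/dominatesXP => v _; rewrite dominated_in ?inE.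
Qed.

Lemma gammaX_le X D : dominatesX e X D -> gammaX e X <= #|D|.
Proof.
rewrite /gammaX; case: arg_minnP => [|D0 _ min]; last exact: min.
by apply/dominatesXP => v _; rewrite dominated_in ?inE.
Qed.

Lemma exp_dominatingT : exp_dominating e setT.
Proof. by apply/forallP => v; rewrite wgt_in ?inE. Qed.

Lemma gamma_eP : exists2 D, exp_dominating e D & #|D| = gamma_e e.
Proof.
rewrite /gamma_e; case: arg_minnP => [|D dD _]; last by exists D.
exact: exp_dominatingT.
Qed.

Lemma gamma_e_le D : exp_dominating e D -> gamma_e e <= #|D|.
Proof.
rewrite /gamma_e; case: arg_minnP => [|D0 _ min]; last exact: min.
exact: exp_dominatingT.
Qed.

Lemma card_swap D a y : a \in D \/ y \in D -> #|y |: (D :\ a)| <= #|D|.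
Proof.
have h : #|y |: (D :\ a)| <= (y \notin D :\ a) + #|D :\ a| by rewrite cardsU1.
case=> [aD|yD].
  by apply: leq_trans h _; rewrite (cardsD1 a D) aD leq_add2r leq_b1.
by apply: subset_leq_card; apply/subsetP => v; rewrite !inE; case/predU1P => [->|/andP[]].
Qed.

Lemma dominated_leaf D a y : symmetric e -> (forall v, e a v -> v = y) ->
  dominated D a -> a \in D \/ y \in D.
Proof.
move=> es aN /dominatedP[|[u uD eua]]; first by left.
by right; rewrite -(aN u) // es.
Qed.

(** The closed neighborhood of the leaf [a] is contained in that of [y]. *)
Lemma dominated_swap D a y v : (forall v, e a v -> v = y) -> e y a ->
  dominated D v -> dominated (y |: (D :\ a)) v.
Proof.
move=> aN eya; have yD : y \in y |: (D :\ a) by rewrite !inE eqxx.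
case/dominatedP => [vD|[u uD euv]].
  have [->|va] := eqVneq v a; first exact: dominated_adj eya.
  by apply: dominated_in; rewrite !inE va vD orbT.
have [ua|ua] := eqVneq u a; last by apply: (@dominated_adj _ u); rewrite // !inE ua uD orbT.
by apply: dominated_in; rewrite (aN v) // -ua.
Qed.

(** Dominating the leaf [a] takes [a] or [x], and either of them dominates [x]. With the next lemma
    this gives the situations in which exempting [x] saves nothing. *)
Lemma dominatesX_leaf_neighbor D x a : symmetric e -> irreflexive e ->
  e x a -> (forall v, e a v -> v = x) ->
  dominatesX e (setT :\ x) D -> dominating e D.
Proof.
move=> es ei exa aN /dominatesXP dD; apply/dominatingP => v.
have [->|vx] := eqVneq v x; last by apply: dD; rewrite !inE vx.
have ax : a != x by apply: contraTneq exa => ->; rewrite ei.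
have [aD|xD] : a \in D \/ x \in D.
  by apply: dominated_leaf => //; apply: dD; rewrite !inE ax.
  by apply: dominated_adj aD _; rewrite es.
exact: dominated_in.
Qed.

(** The leaf [b] must be dominated, so it can be traded for [a], which is adjacent to [x]. *)
Lemma dominatesX_support_neighbor D x a b : symmetric e ->
  e x a -> e a b -> b != x -> (forall v, e b v -> v = a) ->
  dominatesX e (setT :\ x) D ->
  exists2 D1, dominating e D1 & #|D1| <= #|D|.
Proof.
move=> es exa eab bx bN /dominatesXP dD; exists (a |: (D :\ b)); last first.
  by apply: card_swap; apply: dominated_leaf; rewrite // dD // !inE bx.
apply/dominatingP => v; have [->|vx] := eqVneq v x.
  by apply: (@dominated_adj _ a); rewrite ?inE ?eqxx // es.
by apply: dominated_swap => //; rewrite dD // !inE vx.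
Qed.

Hypothesis Te : tree e.

Lemma gamma_e_le_gamma : gamma_e e <= gamma e.
Proof.
by have [D dD <-] := gammaP; apply: gamma_e_le; apply: dominating_exp.
Qed.

Lemma gamma_e_gt0 : 0 < gamma_e e.
Proof.
have [D eD <-] := gamma_eP; have [/card_gt0P[v _] _] := Te.2.
rewrite card_gt0; apply: contraTneq eD => ->.
by apply/forallPn; exists v; rewrite (wgtE Te) ?inE // big_set0.
Qed.

Local Open Scope ring_scope.

(* D is feasible for tau iff tau_candidate x D and tau_bound x D <= tau, so the
   minimum in the definition of tau exists, set0 being a candidate. *)
Definition tau_candidate x D :=
  [&& (#|D| < gamma_e e)%N, x \notin D &
   [forall u, (u \notin D) ==> (half_pow (dist_avoid e D x u) == 0) ==> (1 <= wgt e D u)]].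

Definition tau_bound x D : rat :=
  \big[Num.max/1 - wgt e D x]_(u | (u \notin D) && (half_pow (dist_avoid e D x u) != 0))
    ((1 - wgt e D u) / half_pow (dist_avoid e D x u)).

Lemma half_pow_dist_avoid_self x D :
  x \notin D -> half_pow (dist_avoid e D x x) = 1.
Proof.
by move=> xD; rewrite (half_pow_dist_avoidE Te) pth_refl /= xD expr0 divr1.
Qed.

Lemma tau_feasibleE x t :
  tau_feasible e x t <-> exists2 D, tau_candidate x D & tau_bound x D <= t.
Proof.
split=> [[D [cD xD h]]|[D /and3P[cD xD /forallP c] /bigmax_leP[_ b]]]; exists D.
- rewrite /tau_candidate cD xD; apply/forallP => u.
  apply/implyP => uD; apply/implyP => /eqP h0.
  by have := h u uD; rewrite h0 mul0r addr0.
(* The default value of the maximum is the constraint at [u = x], where the coefficient of [t] is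
   1. *)
- apply/bigmax_leP; split=> [|u /andP[uD hu]].
    by have := h x xD; rewrite half_pow_dist_avoid_self // mul1r -lerBlDl.
  rewrite ler_pdivrMr ?lt_neqAle 1?eq_sym ?hu ?half_pow_ge0 // mulrC lerBlDl.
  exact: h.
- split=> // u uD; have := b u; rewrite uD /=.
  have [h0 _|hu /(_ isT)] := eqVneq (half_pow _) 0.
    by have := c u; rewrite uD h0 eqxx mul0r addr0.
  by rewrite ler_pdivrMr ?lt_neqAle 1?eq_sym ?hu ?half_pow_ge0 // mulrC lerBlDl.
Qed.

(** No path is blocked by the empty set, so no coefficient vanishes and the last condition is
    void. *)
Lemma tau_candidate0 x : tau_candidate x set0.
Proof.
rewrite /tau_candidate cards0 gamma_e_gt0 inE; apply/forallP => u.
apply/implyP => _; apply/implyP; rewrite (half_pow_dist_avoidE Te).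
rewrite (_ : all _ _) ?mul1r ?invr_eq0 ?expf_eq0 ?pnatr_eq0 ?andbF //.
by apply/allP => v _; rewrite /= inE.
Qed.

(** The minimum is attained because there are finitely many sets to choose from. Thresholds for
    [tau] thereby become plain infeasibility of [c]. *)
Lemma tau_gtE x c : tau_gt e x c <-> ~ tau_feasible e x c.
Proof.
split=> [[t [[_ min] ct]] /min|nf]; first by rewrite leNgt ct.
case: (Order.TotalTheory.arg_minP (tau_bound x) (tau_candidate0 x)) => D cD min.
exists (tau_bound x D); split.
  split; first by apply/tau_feasibleE; exists D.
  by move=> t /tau_feasibleE[D' /min]; apply: le_trans.
by rewrite ltNge; apply/negP => h; apply: nf; apply/tau_feasibleE; exists D.
Qed.

End DominationParameters.

Arguments dominatingP {V e D}.

(** * Domination and exponential domination across the attachment vertex *)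

Section Attachment.
Variables (V' V : finType) (e' : rel V') (e : rel V).
Variables (f : V' -> V) (N : seq V) (x : V').
Hypothesis Pf : pendant e' e f N x.
Hypotheses (Te : tree e) (Sc : subcubic e).
Implicit Types (u v w : V') (a b y : V) (D : {set V}).
Let Te' : tree e' := pendant_tree Pf Te.
Local Notation "D ^-f" := (f @^-1: D) (at level 2).

Lemma pendant_dominated_image (D' : {set V'}) u :
  dominated e' D' u -> dominated e (f @: D') (f u).
Proof.
case/dominatedP => [uD|[w wD ewu]]; first by rewrite dominated_in ?imset_f.
by apply: (@dominated_adj _ _ _ (f w)); rewrite ?imset_f // -(pendant_edge Pf).
Qed.

Lemma pendant_dominated_preim D u :
  u != x \/ (forall b, b \in N -> e b (f x) -> b \notin D) ->
  dominated e D (f u) -> dominated e' D^-f u.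
Proof.
move=> h /dominatedP[uD|[b bD ebu]]; first by rewrite dominated_in ?inE.
have [bN|bN] := boolP (b \in N).
  have ux := pendant_attach Pf bN ebu; rewrite ux eqxx in ebu h.
  by case: h => // /(_ b bN ebu); rewrite bD.
have [w bE] := pendant_preim Pf bN; subst b.
by apply: (@dominated_adj _ _ _ w); rewrite ?inE ?(pendant_edge Pf).
Qed.

Lemma pendant_preim_image y (D' : {set V'}) : y \in N -> (y |: f @: D')^-f = D'.
Proof.
move=> yN; apply/setP => u; rewrite !inE (mem_imset _ _ (pendant_inj Pf)).
by case: eqP => // uy; have := pendant_notin Pf u; rewrite uy yN.
Qed.

Lemma pendant_card_image y (D' : {set V'}) : #|y |: f @: D'| <= #|D'|.+1.
Proof. by rewrite cardsU1 (card_imset _ (pendant_inj Pf)) -add1n leq_add2r leq_b1. Qed.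

Lemma pendant_exp_image D : exp_dominating e' D^-f ->
  (forall a, a \in N -> (1 <= wgt e D a)%R) -> exp_dominating e D.
Proof.
move=> /forallP eD h; apply/forallP => a.
have [/h //|/(pendant_preim Pf)[u ->]] := boolP (a \in N).
have [uD|uD] := boolP (u \in D^-f); first by rewrite inE in uD; exact: wgt_in.
exact: le_trans (eD u) (pendant_wgt_ge Pf Te uD).
Qed.

Lemma pendant_gamma_e_retract D :
  exp_dominating e D -> gamma_e e' <= #|D^-f|.+1.
Proof.
move=> eD; apply: leq_trans (gamma_e_le (pendant_exp_retract Pf Te Sc eD)) _.
by rewrite cardsU1 -add1n leq_add2r leq_b1.
Qed.

(** If a minimum set meets [N], that part is traded for the single vertex [x]; if it avoids [N], the
    weights of old vertices are the same in both trees. *)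
Lemma pendant_gamma_e_le : gamma_e e' <= gamma_e e.
Proof.
have [D eD <-] := gamma_eP e; rewrite (pendant_cardD Pf).
have [/eqP D0|] := posnP #|D :&: [set a in N]|.
  rewrite addnC; apply: leq_trans (leq_addl _ _); apply: gamma_e_le.
  apply: (pendant_exp_preim Pf Te) => [|u]; last exact: (forallP eD).
  rewrite disjoint_subset; apply/subsetP => a aD; rewrite inE.
  apply: contraL D0 => aN; rewrite -lt0n card_gt0; apply/set0Pn.
  by exists a; rewrite !inE aD.
by move=> h; apply: leq_trans (pendant_gamma_e_retract eD) _; rewrite -addn1 leq_add2l.
Qed.

Lemma pendant_count D : #|D :&: [set a in N]| = count (mem D) N.
Proof.
have uN : uniq N by case: Pf => -[].
rewrite -size_filter -(card_uniqP _) ?filter_uniq //.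
by apply: eq_card => a; rewrite !inE mem_filter.
Qed.

Lemma pendant_sum (F : V -> rat) D :
  (\sum_(a in N | a \in D) F a = \sum_(a <- N) if a \in D then F a else 0)%R.
Proof. by rewrite big_mkcondr /= big_uniq //; case: Pf => -[]. Qed.

(* The pendant part N sees the rest of the tree as a vertex of weight c placed at
   x: c = 1 for Operation 2 and c = 1/2 for Operation 3, which is where the
   thresholds for tau come from. *)
Section Tail.
Variable c : rat.
Hypothesis tail_hit : forall D, exp_dominating e D -> 0 < #|D :&: [set a in N]|.
Hypothesis tail_wgt_le : forall D u, exp_dominating e D ->
  #|D :&: [set a in N]| = 1 ->
  (\sum_(a in N | a \in D) term Te D (f u) a <= half_pow (dist_avoid e' D^-f x u) * c)%R.

Lemma tail_gamma_e_lower : ~ tau_feasible e' x c -> gamma_e e' < gamma_e e.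
Proof.
move=> nf; rewrite ltnNge; apply/negP => le_ee'; apply: nf.
have [D eD cD] := gamma_eP e; rewrite -cD (pendant_cardD Pf) in le_ee'.
have h1 := tail_hit eD; have hr := pendant_gamma_e_retract eD.
(* [D] has at most [gamma_e e'] elements, at least one of them in [N], while its old part together
   with [x] already needs [gamma_e e'] elements. So exactly one lies in [N], and the old part is a
   witness that [c] is feasible. *)
have D1 : #|D :&: [set a in N]| = 1 by lia.
have Dlt : #|D^-f| < gamma_e e' by lia.
have xD : x \notin D^-f.
  apply: contraL Dlt => xD; rewrite -leqNgt; apply: gamma_e_le.
  exact: (pendant_exp_preim_in Pf Te xD eD).
exists D^-f; split=> // u uD.
apply: le_trans (forallP eD (f u)) _; rewrite (pendant_wgt Pf Te) // lerD2l.
exact: tail_wgt_le.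
Qed.

End Tail.

Section TailCenter.
Variables (y : V) (c : rat).
Hypothesis yN : y \in N.
Hypothesis tail_covered : forall D a, y \in D -> a \in N -> (1 <= wgt e D a)%R.
Hypothesis tail_wgt_ge : forall (D' : {set V'}) u (D := y |: f @: D'),
  (half_pow (dist_avoid e' D' x u) * c <= term Te D (f u) y)%R.

Lemma tail_gamma_e_upper : gamma_e e <= (gamma_e e').+1.
Proof.
have [D' eD <-] := gamma_eP e'; apply: leq_trans (pendant_card_image y D').
apply: gamma_e_le; apply: pendant_exp_image; rewrite ?pendant_preim_image //.
by move=> a; apply: tail_covered; rewrite !inE eqxx.
Qed.

(** A witness of feasibility has fewer than [gamma_e e'] elements, so there is room for [y], which
    covers [N] and supplies the missing weight to the old vertices. *)
Lemma tail_gamma_e_feasible : tau_feasible e' x c -> gamma_e e <= gamma_e e'.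
Proof.
move=> [D' [cD xD h]]; pose D := y |: f @: D'.
apply: leq_trans cD; apply: leq_trans (pendant_card_image y D').
apply: gamma_e_le; apply/forallP => a.
have [aN|/(pendant_preim Pf)[u ->]] := boolP (a \in N).
  by apply: tail_covered; rewrite // !inE eqxx.
have E : D^-f = D' by exact: pendant_preim_image.
have [uD|uD] := boolP (u \in D').
  by apply: wgt_in; rewrite -E inE in uD.
rewrite -/D (pendant_wgt Pf Te) ?E //; apply: le_trans (h u uD) _; rewrite lerD2l.
rewrite (bigD1 y) /=; last by rewrite yN !inE eqxx.
apply: le_trans (tail_wgt_ge _ _) _; rewrite lerDl sumr_ge0 // => b _.
exact: term_ge0.
Qed.

End TailCenter.
End Attachment.

(** * The three operations *)

Lemma embeds_notin (V' V : finType) (e' : rel V') (e : rel V) f N u :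
  embeds_as_minus e' e f N -> f u \notin N.
Proof. by case=> _ -> _ _; rewrite negbK codom_f. Qed.

Section Operation1.
Variables (V' V : finType) (e' : rel V') (e : rel V).
Variables (f : V' -> V) (y : V') (z : V).
Hypothesis Em : embeds_as_minus e' e f [:: z].
Hypothesis ez : forall v, e z v = (v == f y).
Hypotheses (Te : tree e) (Sc : subcubic e).

Lemma op1_pendant : pendant e' e f [:: z] y.
Proof.
split=> // a w; rewrite inE => /eqP->; rewrite ez => /eqP.
by case: Em => fi _ _ _ /fi.
Qed.
Let Pf := op1_pendant.

Let efyz : e (f y) z. Proof. by rewrite tree_sym // ez. Qed.

(** A minimum dominating set containing [y] also dominates the new leaf, so [gamma] does not grow,
    while [gamma_e] does not drop. *)
Lemma op1_gamma_eq : gamma e' = gamma_e e' ->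
  (exists D, [/\ dominating e' D, #|D| = gamma e' & y \in D]) ->
  gamma e = gamma_e e.
Proof.
move=> E [D [/dominatingP dD cD yD]]; apply/eqP; rewrite eqn_leq gamma_e_le_gamma // andbT.
apply: leq_trans (pendant_gamma_e_le Pf Te Sc); rewrite -E -cD.
rewrite -(card_imset _ (pendant_inj Pf)); apply: gamma_le; apply/dominatingP => a.
have [|/(pendant_preim Pf)[u ->]] := boolP (a \in [:: z]).
  by rewrite inE => /eqP->; apply: dominated_adj efyz; rewrite imset_f.
exact: (pendant_dominated_image Pf (dD u)).
Qed.

(** Here [a] is a second leaf at [y]. Trading [a] for [y] turns sets for the smaller tree into sets
    that also serve [z], so the chain [gamma e' <= gamma e = gamma_e e <= gamma_e e'] closes with
    [gamma_e e' <= gamma e']. *)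
Lemma op1_reverse a : (forall v, e' a v -> v = y) -> e' y a ->
  gamma e = gamma_e e ->
  gamma e' = gamma_e e' /\
  exists D, [/\ dominating e' D, #|D| = gamma e' & y \in D].
Proof.
move=> aN eya E; have Te' := pendant_tree Pf Te.
have le_g : gamma e' <= gamma e.
  have [D /dominatingP dD <-] := gammaP e; rewrite (pendant_cardD Pf) (pendant_count Pf) /=.
  have [zD|zD] := boolP (z \in D).
    have le1 : #|y |: f @^-1: D| <= #|f @^-1: D| + (true + 0).
      by rewrite cardsU1 addnC leq_add2l; case: (y \notin _).
    apply: leq_trans le1; apply: gamma_le; apply/dominatingP => u.
    have [->|uy] := eqVneq u y; first by rewrite dominated_in // !inE eqxx.
    apply: dominatedS (subsetUr _ _) _.
    by apply: (pendant_dominated_preim Pf _ (dD (f u))); left.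
  rewrite /= !addn0; apply: gamma_le; apply/dominatingP => u.
  apply: (pendant_dominated_preim Pf _ (dD (f u))).
  by right=> b; rewrite inE => /eqP->.
(* Since [z] uses up one of the three places at [y], at most one old neighbor [p] remains besides
   [a]; if there is none, [a] serves as [p]. *)
have [p yN] : exists p, forall v, e' y v -> v = p \/ v = a.
  case: (pickP [pred p | e' y p & p != a]) => [p /andP[/= eyp pa]|no]; last first.
    exists a => v eyv; right; apply/eqP; move: (no v) => /=; rewrite eyv /=.
    by move/negbFE.
  exists p => v eyv; case: (eqVneq v p) => [|vp]; first by left.
  case: (eqVneq v a) => [|va]; first by right.
  suff : 4 <= #|[pred u | e (f y) u]| by rewrite leqNgt ltnS (Sc (f y)).
  have zf w : z != f w.
    by apply: contraTneq (embeds_notin w Em) => <-; rewrite inE eqxx.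
  have us : uniq [:: z; f v; f p; f a].
    rewrite /= !inE !negb_or !zf !(inj_eq (pendant_inj Pf)).
    by rewrite (negPf vp) (negPf va) (negPf pa).
  rewrite -[4](card_uniqP us); apply: subset_leq_card; apply/subsetP => w.
  by rewrite !inE; case/or4P => /eqP->; rewrite ?efyz // -(pendant_edge Pf).
have le_ge : gamma_e e <= gamma_e e'.
  have [D eD cD] := gamma_eP e'; pose D1 := y |: (D :\ a).
  have [ay ya] : a != y /\ y != a.
    by split; [|rewrite eq_sym]; apply: contraTneq eya => ->; rewrite tree_irr.
  have hit : a \in D \/ y \in D.
    case: (boolP (a \in D)) => [|aD]; first by left.
    case: (boolP (y \in D)) => [|yD]; first by right.
    have := wgt_leaf_lt1 Te' (pendant_subcubic Pf Sc) aN yN yD aD.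
    by rewrite ltNge (forallP eD).
  rewrite -cD; apply: leq_trans (card_swap hit); rewrite -/D1.
  have eD1 : exp_dominating e' D1.
    apply/forallP => u; have [->|ua] := eqVneq u a.
      apply: (@wgt_adj _ _ Te' _ _ y); rewrite ?inE ?eqxx ?(negPf ay) //.
      by rewrite (tree_sym Te').
    apply: (exp_dominating_retract Te' (pendant_subcubic Pf Sc)).
    - by rewrite inE.
    - by move=> b v; rewrite !inE => /eqP-> /aN ->; rewrite eqxx orbT.
    - by rewrite inE.
    - exact: (forallP eD).
  rewrite -(card_imset _ (pendant_inj Pf)); apply: gamma_e_le.
  have pre : f @^-1: (f @: D1) = D1.
    by apply/setP => u; rewrite inE (mem_imset _ _ (pendant_inj Pf)).
  apply: (pendant_exp_image Pf Te); first by rewrite pre.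
  move=> b; rewrite inE => /eqP->.
  apply: (@wgt_adj _ _ Te _ _ (f y)); rewrite ?ez //.
    by apply/imsetP => -[w _ zE]; have := embeds_notin w Em; rewrite -zE inE eqxx.
  by rewrite imset_f // !inE eqxx.
split.
  apply/eqP; rewrite eqn_leq gamma_e_le_gamma // andbT.
  by apply: leq_trans le_g _; rewrite E.
have [D dD cD] := gammaP e'; exists (y |: (D :\ a)); rewrite !inE eqxx; split=> //.
  by apply/dominatingP => v; apply: (dominated_swap aN eya); exact: (dominatingP dD).
apply/eqP; rewrite eqn_leq gamma_le ?andbT; last first.
  by apply/dominatingP => v; apply: (dominated_swap aN eya); exact: (dominatingP dD).
rewrite -cD; apply: card_swap; apply: (dominated_leaf (tree_sym Te') aN).
exact: (dominatingP dD).
Qed.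

End Operation1.

Lemma pendant_path_hit (V : finType) (e : rel V) D x y z :
  tree e -> subcubic e ->
  (forall v, e y v = (v == x) || (v == z)) -> (forall v, e z v = (v == y)) ->
  exp_dominating e D -> (y \in D) || (z \in D).
Proof.
move=> Te Sc ey ez /forallP eD; case: (boolP (y \in D)) => //= yD.
apply: contraT => zD; have := @wgt_leaf_lt1 _ _ Te Sc D x y z.
rewrite ltNge eD; apply=> // v; first by rewrite ez => /eqP.
by rewrite ey => /orP[]/eqP; [left | right].
Qed.

Section Operation2.
Variables (V' V : finType) (e' : rel V') (e : rel V).
Variables (f : V' -> V) (x : V') (y z : V).
Hypothesis Em : embeds_as_minus e' e f [:: y; z].
Hypothesis ey : forall v, e y v = (v == f x) || (v == z).
Hypothesis ez : forall v, e z v = (v == y).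
Hypotheses (Te : tree e) (Sc : subcubic e).

Lemma op2_pendant : pendant e' e f [:: y; z] x.
Proof.
have nf w : (f w == y) = false /\ (f w == z) = false.
  by have := embeds_notin w Em; rewrite !inE negb_or => /andP[/negPf-> /negPf->].
split=> // a w; rewrite !inE => /orP[]/eqP->.
  by rewrite ey (nf w).2 orbF; case: Em => fi _ _ _ /eqP/fi.
by rewrite ez (nf w).1.
Qed.
Let Pf := op2_pendant.
Let Te' := pendant_tree Pf Te.

Let nyz : y != z.
Proof. by case: Em => _ _ /andP[]; rewrite inE. Qed.

Let efxy : e (f x) y. Proof. by rewrite tree_sym // ey eqxx. Qed.
Let eyz : e y z. Proof. by rewrite ey eqxx orbT. Qed.

Let hit D : exp_dominating e D -> (y \in D) || (z \in D).
Proof. exact: pendant_path_hit. Qed.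

Let hit_card D : exp_dominating e D -> 0 < #|D :&: [set a in [:: y; z]]|.
Proof.
by move=> /hit; rewrite (pendant_count Pf) /=; case: (y \in D); case: (z \in D).
Qed.

Let covered (D : {set V}) a : y \in D -> a \in [:: y; z] -> (1 <= wgt e D a)%R.
Proof.
move=> yD; rewrite !inE => /orP[]/eqP->; first exact: wgt_in.
have [zD|zD] := boolP (z \in D); first exact: wgt_in.
by apply: (wgt_adj Te zD yD); rewrite ez.
Qed.

Let term_y (D : {set V}) u :
  term Te D (f u) y = half_pow (dist_avoid e' (f @^-1: D) x u).
Proof.
rewrite (pendant_term_out Pf Te D u (b := y) (r := [::])).
- by rewrite /= mul1r expr1 divff ?mulr1.
- by rewrite /= inE eqxx.
- rewrite /simple_path /= efxy eqxx inE /= andbT.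
  by apply: contraTneq efxy => ->; rewrite tree_irr.
Qed.

Let term_z (D : {set V}) u :
  (term Te D (f u) z <= half_pow (dist_avoid e' (f @^-1: D) x u))%R.
Proof.
rewrite (pendant_term_out Pf Te D u (b := y) (r := [:: z])).
- rewrite ler_piMr ?half_pow_ge0 //.
  by case: (all _ _); rewrite /= ?mul0r // mul1r expr2; lra.
- by rewrite /= !inE !eqxx orbT.
- have := embeds_notin x Em.
  by rewrite /simple_path /= efxy eyz eqxx !inE (negPf nyz) => ->.
Qed.

Let wgt_le D u : exp_dominating e D -> #|D :&: [set a in [:: y; z]]| = 1 ->
  (\sum_(a in [:: y; z] | a \in D) term Te D (f u) a
     <= half_pow (dist_avoid e' (f @^-1: D) x u) * 1)%R.
Proof.
move=> _; rewrite (pendant_count Pf) (pendant_sum Pf) !big_cons big_nil mulr1 /=.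
have := term_z D u; rewrite term_y.
by case: (y \in D); case: (z \in D) => //; rewrite ?addr0 ?add0r.
Qed.

Let wgt_ge (D1 : {set V'}) u (D := y |: f @: D1) :
  (half_pow (dist_avoid e' D1 x u) * 1 <= term Te D (f u) y)%R.
Proof. by rewrite term_y (pendant_preim_image Pf) ?inE ?eqxx // mulr1. Qed.

Let yN : y \in [:: y; z]. Proof. by rewrite inE eqxx. Qed.

(** Adding [y] dominates [x], [y] and [z] at once, so the old part may leave [x] undominated. *)
Lemma op2_gamma_le : gamma e <= (gammaX e' (setT :\ x)).+1.
Proof.
have [D /dominatesXP dD <-] := gammaXP e' (setT :\ x).
apply: leq_trans (pendant_card_image Pf y D); apply: gamma_le; apply/dominatingP => a.
have yD : y \in y |: f @: D by rewrite !inE eqxx.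
have [|/(pendant_preim Pf)[u ->]] := boolP (a \in [:: y; z]).
  by rewrite !inE => /orP[]/eqP->; [apply: dominated_in | apply: dominated_adj eyz].
have [->|ux] := eqVneq u x.
  by apply: dominated_adj yD _; rewrite ey eqxx.
apply: dominatedS (subsetUr _ _) _; apply: (pendant_dominated_image Pf).
by apply: dD; rewrite !inE ux.
Qed.

(** If [tau] exceeds 1, both parameters grow by exactly one. If exempting [x] saves a vertex, that
    saving pays for [y] and [gamma] does not grow. *)
Lemma op2_gamma_eq : gamma e' = gamma_e e' ->
  tau_gt e' x 1%R \/ gammaX e' (setT :\ x) < gamma e' ->
  gamma e = gamma_e e.
Proof.
move=> E h; apply/eqP; rewrite eqn_leq gamma_e_le_gamma // andbT.
apply: leq_trans op2_gamma_le _; case: h => [/(tau_gtE Te')|] h.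
  apply: leq_trans (tail_gamma_e_lower Pf Sc hit_card wgt_le h).
  rewrite ltnS -E; have [D /dominatingP dD <-] := gammaP e'.
  by apply: gammaX_le; apply/dominatesXP => v _; exact: dD.
by apply: leq_trans h _; rewrite E (pendant_gamma_e_le Pf).
Qed.

(** The first hypothesis says that exempting [x] saves nothing, so deleting [y] and [z] lowers
    [gamma]. As [gamma_e] drops by at most one, equality passes to the smaller tree; and were 1
    feasible, [gamma_e] would not drop at all, contradicting [gamma_e e' <= gamma e']. *)
Lemma op2_reverse :
  (forall D, dominatesX e' (setT :\ x) D ->
     exists2 D1, dominating e' D1 & #|D1| <= #|D|) ->
  gamma e = gamma_e e ->
  gamma e' = gamma_e e' /\ tau_gt e' x 1%R.
Proof.
move=> fill E; have lt_g : gamma e' < gamma e.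
  have [D dD <-] := gammaP e; rewrite (pendant_cardD Pf).
  have [|D1 dD1 cD1] := fill (f @^-1: D).
    apply/dominatesXP => u; rewrite !inE andbT => ux.
    by apply: (pendant_dominated_preim Pf); [left | exact: (dominatingP dD)].
  have h := hit_card (dominating_exp Te dD).
  by have := gamma_le dD1; lia.
have up := tail_gamma_e_upper Pf Te yN covered.
have le := gamma_e_le_gamma Te'.
split; first by lia.
apply/(tau_gtE Te') => /(tail_gamma_e_feasible Pf yN covered wgt_ge).
lia.
Qed.

End Operation2.

Section Operation3.
Variables (V' V : finType) (e' : rel V') (e : rel V).
Variables (f : V' -> V) (w : V') (x y z : V).
Hypothesis Em : embeds_as_minus e' e f [:: x; y; z].
Hypothesis ex : forall v, e x v = (v == f w) || (v == y).
Hypothesis ey : forall v, e y v = (v == x) || (v == z).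
Hypothesis ez : forall v, e z v = (v == y).
Hypotheses (Te : tree e) (Sc : subcubic e).

Let nf v : [&& f v != x, f v != y & f v != z].
Proof. by have := embeds_notin v Em; rewrite !inE !negb_or. Qed.

Lemma op3_pendant : pendant e' e f [:: x; y; z] w.
Proof.
split=> // a v; have /and3P[/negPf fx /negPf fy /negPf fz] := nf v.
rewrite !inE => /or3P[]/eqP->.
- by rewrite ex fy orbF; case: Em => fi _ _ _ /eqP/fi.
- by rewrite ey fx fz.
- by rewrite ez fy.
Qed.
Let Pf := op3_pendant.
Let Te' := pendant_tree Pf Te.

Let uxyz : uniq [:: x; y; z]. Proof. by case: Em. Qed.

Let efwx : e (f w) x. Proof. by rewrite tree_sym // ex eqxx. Qed.
Let exy : e x y. Proof. by rewrite ex eqxx orbT. Qed.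
Let eyz : e y z. Proof. by rewrite ey eqxx orbT. Qed.

Let hit D : exp_dominating e D -> (y \in D) || (z \in D).
Proof. exact: pendant_path_hit. Qed.

Let hit_card D : exp_dominating e D -> 0 < #|D :&: [set a in [:: x; y; z]]|.
Proof.
move=> /hit; rewrite (pendant_count Pf) /=.
by case: (x \in D); case: (y \in D); case: (z \in D).
Qed.

Let covered (D : {set V}) a : y \in D -> a \in [:: x; y; z] -> (1 <= wgt e D a)%R.
Proof.
move=> yD aN; have [aD|aD] := boolP (a \in D); first exact: wgt_in.
apply: (wgt_adj Te aD yD); move: aN aD; rewrite !inE => /or3P[]/eqP-> //.
  by rewrite yD.
by rewrite ez.
Qed.

Let term_y (D : {set V}) u : x \notin D ->
  (term Te D (f u) y = half_pow (dist_avoid e' (f @^-1: D) w u) * (1 / 2%:R))%R.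
Proof.
move=> xD; rewrite (pendant_term_out Pf Te D u (b := x) (r := [:: y])).
- by rewrite /= xD; congr (_ * _)%R; rewrite mul1r expr2; lra.
- by rewrite /= !inE !eqxx orbT.
- have := nf w; case/and3P: uxyz => xy _ _ /and3P[h1 h2 _].
  move: xy; rewrite /simple_path /= efwx exy eqxx !inE !negb_or h1 h2.
  by case/andP=> ->.
Qed.

Let term_z (D : {set V}) u :
  (term Te D (f u) z <= half_pow (dist_avoid e' (f @^-1: D) w u) * (1 / 2%:R))%R.
Proof.
rewrite (pendant_term_out Pf Te D u (b := x) (r := [:: y; z])).
- apply: ler_wpM2l; rewrite ?half_pow_ge0 //.
  by case: (all _ _); rewrite /= ?mul0r // ?mul1r !exprS expr0; lra.
- by rewrite /= !inE !eqxx !orbT.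
- by rewrite /simple_path cons_uniq (embeds_notin w Em) uxyz /= efwx exy eyz eqxx.
Qed.

Let wgt_le D u : exp_dominating e D -> #|D :&: [set a in [:: x; y; z]]| = 1 ->
  (\sum_(a in [:: x; y; z] | a \in D) term Te D (f u) a
     <= half_pow (dist_avoid e' (f @^-1: D) w u) * (1 / 2%:R))%R.
Proof.
move=> /hit; rewrite (pendant_count Pf) (pendant_sum Pf) !big_cons big_nil /=.
(* If [x] were in [D], then [y] or [z] would be a second new vertex of [D], against the count. So
   [x] does not block the path to [y]. *)
have := term_z D u; case: (boolP (x \in D)) => [|/term_y ->].
  by case: (y \in D); case: (z \in D).
by case: (y \in D); case: (z \in D) => //; rewrite ?addr0 ?add0r.
Qed.

Let wgt_ge (D1 : {set V'}) u (D := y |: f @: D1) :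
  (half_pow (dist_avoid e' D1 w u) * (1 / 2%:R) <= term Te D (f u) y)%R.
Proof.
rewrite term_y ?(pendant_preim_image Pf) ?inE ?eqxx ?orbT //.
case/and3P: uxyz; rewrite !inE !negb_or => /andP[-> _] _ _ /=.
by apply/imsetP => -[v _ xE]; have := nf v; rewrite -xE eqxx.
Qed.

Let yN : y \in [:: x; y; z]. Proof. by rewrite !inE eqxx orbT. Qed.

Lemma op3_gamma_le : gamma e <= (gamma e').+1.
Proof.
have [D /dominatingP dD <-] := gammaP e'.
apply: leq_trans (pendant_card_image Pf y D); apply: gamma_le; apply/dominatingP => a.
have yD : y \in y |: f @: D by rewrite !inE eqxx.
have [|/(pendant_preim Pf)[u ->]] := boolP (a \in [:: x; y; z]).
  rewrite !inE => /or3P[]/eqP->; [|exact: dominated_in|exact: dominated_adj eyz].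
  by apply: dominated_adj yD _; rewrite ey eqxx.
by apply: dominatedS (subsetUr _ _) _; apply: (pendant_dominated_image Pf).
Qed.

Lemma op3_gamma_eq : gamma e' = gamma_e e' -> tau_gt e' w (1 / 2%:R)%R ->
  gamma e = gamma_e e.
Proof.
move=> E /(tau_gtE Te') h; apply/eqP; rewrite eqn_leq gamma_e_le_gamma // andbT.
apply: leq_trans op3_gamma_le _; rewrite E.
exact: (tail_gamma_e_lower Pf Sc hit_card wgt_le h).
Qed.

(** A dominating set uses [y] or [z], and neither dominates an old vertex. If it also uses [x], then
    [x] is traded for [w], and at least one vertex is still saved. *)
Lemma op3_gamma_lt : gamma e' < gamma e.
Proof.
have [D dD <-] := gammaP e; rewrite (pendant_cardD Pf) (pendant_count Pf) /=.
have h := hit (dominating_exp Te dD).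
have [xD|xD] := boolP (x \in D).
  have dD1 : dominating e' (w |: f @^-1: D).
    apply/dominatingP => u.
    have [->|uw] := eqVneq u w; first by rewrite dominated_in // !inE eqxx.
    apply: dominatedS (subsetUr _ _) _.
    by apply: (pendant_dominated_preim Pf _ (dominatingP dD (f u))); left.
  have := gamma_le dD1; rewrite cardsU1.
  by case: (w \notin _) h; case: (y \in D); case: (z \in D) => //= _; lia.
have dD1 : dominating e' (f @^-1: D).
  apply/dominatingP => u; apply: (pendant_dominated_preim Pf _ (dominatingP dD (f u))).
  have /and3P[/negPf fx /negPf fy /negPf fz] := nf w.
  right=> b; rewrite !inE => /or3P[]/eqP-> //; first by rewrite ey fx fz.
  by rewrite ez fy.
have := gamma_le dD1.
by case: (y \in D) h; case: (z \in D) => //= _; lia.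
Qed.

Lemma op3_reverse : gamma e = gamma_e e ->
  gamma e' = gamma_e e' /\ tau_gt e' w (1 / 2%:R)%R.
Proof.
move=> E; have lt_g := op3_gamma_lt.
have up := tail_gamma_e_upper Pf Te yN covered.
have le := gamma_e_le_gamma Te'.
split; first by lia.
apply/(tau_gtE Te') => /(tail_gamma_e_feasible Pf yN covered wgt_ge).
lia.
Qed.

End Operation3.

(** * Ends of longest paths *)

Section Longest.
Variables (V : finType) (e : rel V).
Hypothesis Te : tree e.
Implicit Types (x y z a b v : V) (p s : seq V).

Definition is_path s := if s is z :: p then path e z p && uniq (z :: p) else false.

Definition longest_path s := is_path s /\ forall t, is_path t -> size t <= size s.

Lemma longest_path_exists : exists z p, longest_path (z :: p).
Proof.
pose P n := [exists s : n.-tuple V, is_path s].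
have P1 : exists n, P n.
  have [/card_gt0P[v _] _] := Te.2.
  by exists 1; apply/existsP; exists [tuple v].
have ubP n : P n -> n <= #|V|.
  case/existsP => s; case E: (val s) => [|z p] // /andP[_ /card_uniqP us].
  by rewrite -(size_tuple s) E -us max_card.
case: (ex_maxnP P1 ubP) => n /existsP[s ps] max.
case E: (val s) ps => [|z p] // ps; exists z, p; split=> // t pt.
rewrite -E size_tuple; apply: max.
by apply/existsP; exists (in_tuple t).
Qed.

(** If [v] were on the path, the part up to [v] would be the edge [z v] by uniqueness of paths,
    making [v] the next vertex. *)
Lemma is_path_neighbor z p v :
  is_path (z :: p) -> e z v -> ohead p != Some v -> v \notin z :: p.
Proof.
move=> /andP[pp up] ezv; rewrite inE negb_or.
rewrite (_ : v != z) /=; last by apply: contraTneq ezv => ->; rewrite tree_irr.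
apply: contra => vp; case: (path.splitP vp) pp up => p1 p2.
rewrite cat_path -cat_cons cat_uniq => /andP[pp _] /andP[up _].
have := @pthE _ _ Te z v (rcons p1 v); rewrite (pth_adj Te ezv) => <- //.
by apply/and3P; rewrite last_rcons.
Qed.

(** Any other neighbor could be put in front of the path. For empty [p] the conclusion is absurd, so
    [z] is then isolated. *)
Lemma longest_path_leaf z p v : longest_path (z :: p) -> e z v -> ohead p = Some v.
Proof.
move=> [pz max] ezv; apply/eqP; apply: contraT => h.
have vn := is_path_neighbor pz ezv h; case/andP: pz => pp up.
have pv : is_path (v :: z :: p).
  by rewrite /is_path cons_uniq vn up /= (tree_sym Te) ezv pp.
by have := max _ pv; rewrite ltnn.
Qed.

Lemma longest_path_swap z y a p : longest_path (z :: y :: p) ->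
  e y a -> ohead p != Some a -> longest_path (a :: y :: p).
Proof.
move=> [/andP[/andP[_ pp] /andP[_ up]] max] eya h; split=> //.
have an : a \notin y :: p.
  by apply: is_path_neighbor eya h; apply/andP.
by apply/andP; rewrite cons_uniq an; split=> //=; rewrite (tree_sym Te) eya.
Qed.

Lemma isolated_card1 z : (forall v, ~~ e z v) -> #|V| = 1.
Proof.
move=> ez; rewrite (eq_card1 (x := z)) // => v; rewrite !inE.
case/connectP: (tree_connect Te z v) => -[|a p] /=; first by move=> _ ->; rewrite eqxx.
by rewrite (negPf (ez a)).
Qed.

Lemma card1_obtainable : #|V| = 1 -> obtainable e.
Proof.
move=> V1; apply: obt_P1 => // u v.
have /fintype_le1P/(_ u v) -> : #|V| <= 1 by rewrite V1.
by rewrite tree_irr.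
Qed.

End Longest.

(** * Deletion of vertices and the two directions of the equivalence *)

Section Deletion.
Variables (V : finType) (e : rel V) (N : seq V).

Definition minus_type := {v : V | v \notin N}.
Definition minus_rel : rel minus_type := relpre val e.

Lemma minus_embeds : uniq N -> embeds_as_minus minus_rel e val N.
Proof.
move=> uN; split=> // [|v]; first exact: val_inj.
have [vN|vN] := boolP (v \in N); apply/esym.
  by apply/negP => /codomP[u vE]; have := valP u; rewrite -vE vN.
by apply/negbF/codomP; exists (Sub v vN).
Qed.

End Deletion.

(** [familyT] asks for degree at most 3 only in the final tree. Being a subcubic tree is inherited
    by the smaller trees, so both assumptions are kept inside the induction and passed down. *)
Lemma obtainable_gamma_eq (V : finType) (e : rel V) :
  obtainable e -> tree e -> subcubic e -> gamma e = gamma_e e.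
Proof.
elim=> {V e} [V e V1 ne|V' V e' e _ _ IH|V' V e' e _ _ IH|V' V e' e _ _ IH].
- move=> Te _; apply/eqP; rewrite eqn_leq gamma_e_le_gamma // andbT.
  apply: leq_trans (gamma_e_gt0 Te); rewrite -V1 -cardsT; apply: gamma_le.
  by apply/dominatingP => v; rewrite dominated_in ?inE.
- move=> [f [y [z [Em ez D]]]] Te Sc; have Pf := op1_pendant Em ez.
  apply: (op1_gamma_eq Em ez) => //; apply: IH; first exact: (pendant_tree Pf Te).
  exact: (pendant_subcubic Pf Sc).
- move=> [f [x [y [z [Em ey ez h]]]]] Te Sc; have Pf := op2_pendant Em ey ez.
  apply: (op2_gamma_eq Em ey ez) => //; apply: IH; first exact: (pendant_tree Pf Te).
  exact: (pendant_subcubic Pf Sc).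
- move=> [f [w [x [y [z [Em ex ey ez h]]]]]] Te Sc.
  have Pf := op3_pendant Em ex ey ez.
  apply: (op3_gamma_eq Em ex ey ez) => //; apply: IH; first exact: (pendant_tree Pf Te).
  exact: (pendant_subcubic Pf Sc).
Qed.

Section Decomposition.
Variables (V : finType) (e : rel V).
Hypotheses (Te : tree e) (Sc : subcubic e) (E : gamma e = gamma_e e).
Hypothesis IH : forall (V' : finType) (e' : rel V'), #|V'| < #|V| ->
  tree e' -> subcubic e' -> gamma e' = gamma_e e' -> obtainable e'.

Let pendant_obtainable (V' : finType) (e' : rel V') f n N (x : V') :
  pendant e' e f (n :: N) x -> gamma e' = gamma_e e' -> obtainable e'.
Proof.
move=> Pf; apply: IH; first by rewrite (pendant_card Pf) addnS ltnS leq_addr.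
  exact: (pendant_tree Pf Te).
exact: (pendant_subcubic Pf Sc).
Qed.

Lemma two_leaves_obtainable y z a : z != a -> e y z -> e y a ->
  (forall v, e z v = (v == y)) -> (forall v, e a v -> v = y) -> obtainable e.
Proof.
move=> za eyz eya ez ea; have Em := minus_embeds e (isT : uniq [:: z]).
have nyz : y \notin [:: z].
  by rewrite inE; apply: contraTneq eyz => ->; rewrite tree_irr.
have naz : a \notin [:: z] by rewrite inE eq_sym.
have Pf := @op1_pendant _ _ _ _ _ (Sub y nyz) _ Em ez.
have [|//|//|E' D] := @op1_reverse _ _ _ _ _ (Sub y nyz) z Em ez Te Sc (Sub a naz).
  by move=> v /ea vy; apply: val_inj.
apply: obt_op1 (pendant_obtainable Pf E') _; first exact: Te.1.
by exists val, (Sub y nyz), z; split.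
Qed.

(** On a single edge there is no second leaf at [y] to trade, but deleting [z] leaves one vertex,
    which every dominating set contains. *)
Lemma single_edge_obtainable y z :
  (forall v, e y v -> v = z) -> (forall v, e z v = (v == y)) -> obtainable e.
Proof.
move=> ey ez; have Em := minus_embeds e (isT : uniq [:: z]).
have nyz : y \notin [:: z].
  rewrite inE; apply/negP => /eqP yz; have := ez y.
  by rewrite -yz tree_irr // eqxx.
have Pf := @op1_pendant _ _ _ _ _ (Sub y nyz) _ Em ez.
have Te' := pendant_tree Pf Te.
have V1 : #|{: minus_type [:: z]}| = 1.
  apply: (isolated_card1 Te' (z := Sub y nyz)) => v; apply/negP => /ey vz.
  by have := valP v; rewrite /= vz inE eqxx.
apply: obt_op1 (card1_obtainable Te' V1) _; first exact: Te.1.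
exists val, (Sub y nyz), z; split=> //.
have [D dD cD] := gammaP (minus_rel e (N := [:: z])); exists D; split=> //.
have /fintype_le1P all_eq : #|{: minus_type [:: z]}| <= 1 by rewrite V1.
by case/dominatedP: (dominatingP dD (Sub y nyz)) => [//|[u uD _]];
  rewrite (all_eq u (Sub y nyz)).
Qed.

(** A further neighbor [a] of [x] that is a leaf, or is adjacent to a leaf, guarantees that
    exempting [x] from domination saves nothing. *)
Lemma pendant_edge_obtainable x y z a : uniq [:: x; y; z] -> a != y -> a != z ->
  (forall v, e y v = (v == x) || (v == z)) -> (forall v, e z v = (v == y)) ->
  e x a ->
  (forall v, e a v -> v = x) \/
  (exists2 b, e a b /\ b != x & forall v, e b v -> v = a) -> obtainable e.
Proof.
move=> ux ay az ey ez exa ha.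
have [nx uyz] := andP ux; have Em := @minus_embeds _ e [:: y; z] uyz.
have na : a \notin [:: y; z] by rewrite !inE negb_or ay az.
have Pf := @op2_pendant _ _ _ _ _ (Sub x nx) _ _ Em ey ez.
have Te' := pendant_tree Pf Te.
have [D dD|E' tau] := @op2_reverse _ _ _ _ _ (Sub x nx) y z Em ey ez Te Sc _ E.
  case: ha => [ea|[b [eab bx] eb]].
    exists D => //; apply: (dominatesX_leaf_neighbor (tree_sym Te') (tree_irr Te') _ _ dD).
      by instantiate (1 := Sub a na).
    by move=> v /ea vx; apply: val_inj.
  have nb : b \notin [:: y; z].
    rewrite !inE negb_or; apply/andP; split; apply: contraTneq eab => ->.
      rewrite tree_sym // ey (negPf az) orbF.
      by apply: contraTneq exa => ->; rewrite tree_irr.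
    by rewrite tree_sym // ez.
  apply: (dominatesX_support_neighbor (tree_sym Te')
            (a := Sub a na) (b := Sub b nb) _ _ _ _ dD) => //.
  by move=> v /eb va; apply: val_inj.
apply: obt_op2 (pendant_obtainable Pf E') _; first exact: Te.1.
by exists val, (Sub x nx), y, z; split=> //; left.
Qed.

Lemma pendant_path_obtainable w x y z : uniq [:: w; x; y; z] ->
  (forall v, e x v = (v == w) || (v == y)) ->
  (forall v, e y v = (v == x) || (v == z)) ->
  (forall v, e z v = (v == y)) -> obtainable e.
Proof.
move=> uw ex ey ez.
have [nw uxyz] := andP uw; have Em := @minus_embeds _ e [:: x; y; z] uxyz.
have Pf := @op3_pendant _ _ _ _ _ (Sub w nw) _ _ _ Em ex ey ez.
have [E' tau] := @op3_reverse _ _ _ _ _ (Sub w nw) x y z Em ex ey ez Te Sc E.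
apply: obt_op3 (pendant_obtainable Pf E') _; first exact: Te.1.
by exists val, (Sub w nw), x, y, z; split.
Qed.

Lemma gamma_eq_obtainable_step : obtainable e.
Proof.
have sym := tree_sym Te.
have [z [p L]] := longest_path_exists Te.
case: p L => [|y p] L.
  apply: (card1_obtainable Te); apply: (isolated_card1 Te (z := z)) => v.
  by apply/negP => /(longest_path_leaf Te L).
have [pz uz] := andP L.1.
have ezy : e z y by case/andP: pz.
have ez v : e z v = (v == y).
  by apply/idP/eqP => [/(longest_path_leaf Te L) [->]|->].
(* A neighbor [a] of [y] off the path can replace [z] as the end of a longest path, so it is a leaf
   too. *)
have [a /and3P[eya az ap]|no_a] := pickP [pred a | [&& e y a, a != z & ohead p != Some a]].
  apply: (@two_leaves_obtainable y z a) => //; rewrite 1?eq_sym 1?sym //.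
  by move=> v /(longest_path_leaf Te (longest_path_swap Te L eya ap)) [->].
have ey v : e y v -> v = z \/ ohead p = Some v.
  move=> eyv; have := no_a v; rewrite /= eyv /=.
  by case: eqP => [|_ /= /negbFE/eqP]; [left | right].
case: p L pz uz ey {no_a} => [|x p] L pz uz ey.
  by apply: (@single_edge_obtainable y z) => // v /ey[].
have [eyx pp] : e y x /\ path e x p by case/and3P: pz.
have ey' v : e y v = (v == x) || (v == z).
  by apply/idP/orP => [/ey[->|[->]]|[]/eqP->];
     [right | left | exact: eyx | rewrite sym].
have uxyz : uniq [:: x; y; z].
  by move: uz; rewrite /= !inE !negb_or => /and3P[/and3P[zy zx _] /andP[yx _] _];
     rewrite [x == y]eq_sym [x == z]eq_sym [y == z]eq_sym yx zx zy.
have ux : uniq (x :: p) by case/and3P: uz.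
have [a /and3P[exa ay ap]|no_a] := pickP [pred a | [&& e x a, a != y & ohead p != Some a]].
  have an : a \notin x :: p by apply: (is_path_neighbor Te); rewrite // /is_path pp.
  have az : a != z.
    apply: contraTneq exa => ->; rewrite sym ez.
    by case/and3P: uxyz; rewrite !inE negb_or => /andP[].
  apply: (@pendant_edge_obtainable x y z a) => //.
  have [b /andP[/= eab bx]|no_b] := pickP [pred b | e a b & b != x]; last first.
    by left=> v eav; apply/eqP; have := no_b v; rewrite /= eav /= => /negbFE.
  right; exists b => // v.
  have pa : is_path e (a :: x :: p) by rewrite /is_path cons_uniq an ux /= sym exa pp.
  have bn : b \notin a :: x :: p.
    by apply: (is_path_neighbor Te) => //; apply: contra bx => /eqP[->].
  (* This path is as long as the original one, with [b] and [a] in the places of [z] and [y]; hence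
     [b] is a leaf. *)
  have Lb : longest_path e (b :: a :: x :: p).
    split; last exact: L.2.
    case/andP: pa => pa ua; apply/andP; rewrite cons_uniq bn.
    by split=> //=; rewrite (sym b) eab.
  by move=> /(longest_path_leaf Te Lb)[->].
have ex v : e x v -> v = y \/ ohead p = Some v.
  move=> exv; have := no_a v; rewrite /= exv /=.
  by case: eqP => [|_ /= /negbFE/eqP]; [left | right].
(* If the path stops at [x], then [x] is a second leaf at [y]. Otherwise [x] has degree 2 and
   Operation 3 is undone. *)
case: p L pz uz ux pp ex {no_a ey} => [|w p] L pz uz ux pp ex.
  apply: (@two_leaves_obtainable y z x) => //; rewrite 1?sym //.
    by case/and3P: uxyz; rewrite !inE negb_or (eq_sym x z) => /andP[].
  by move=> v /ex[].
apply: (@pendant_path_obtainable w x y z) => //.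
  rewrite cons_uniq uxyz andbT; move: uz; rewrite /= !inE !negb_or.
  move=> /and4P[/and4P[_ _ zw _] /and3P[_ yw _] /andP[xw _] _].
  by rewrite ![w == _]eq_sym xw yw zw.
move=> v; have exw : e x w by case/andP: pp.
by apply/idP/orP => [/ex[->|[->]]|[]/eqP->];
   [right | left | exact: exw | rewrite sym].
Qed.

End Decomposition.

Lemma gamma_eq_obtainable (V : finType) (e : rel V) :
  tree e -> subcubic e -> gamma e = gamma_e e -> obtainable e.
Proof.
have [n] := ubnP #|V|; elim: n V e => // n IH V e ltn Te Sc E.
apply: gamma_eq_obtainable_step => // V' e' lt'; apply: IH.
by apply: leq_trans lt' _; rewrite -ltnS.
Qed.

Theorem theorem1 (V : finType) (e : rel V) :
  simple_graph e -> is_tree e -> subcubic e ->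
  (gamma e = gamma_e e <-> familyT e).
Proof.
move=> Ge Te Sc; have T : tree e by split.
split=> [E|[_ obt]]; last exact: obtainable_gamma_eq.
by split=> //; apply: gamma_eq_obtainable.
Qed.
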